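(* Let $\hat w^{(N)}$ be the iterates of the fast greedy model averaging algorithm with backtracking parameter $\gamma>1$, and let $\hat w\in\operatorname{argmin}_{w\in\mathcal W^K}CV(w)$. For any $N\in\mathbb N$, $$\frac{CV(\hat w^{(N)})}n\le\frac{CV(\hat w)}n+\frac{2\gamma L_{CV}\|\hat w^{(0)}-\hat w\|_2^2}{(N+1)^2},$$ where $L_{CV}=\max_{\|z\|_1\le5}|||\nabla^2CV(z)/n|||_2$.
   Context: $|||\cdot|||_2$ is the spectral norm; $\mathcal W^K=\{w\in[0,1]^K:\sum_kw_k=1\}$; $\Pi_{\mathcal W^K}(u)=\operatorname{argmin}_{w\in\mathcal W^K}\|w-u\|_2$; $e^{(k)}$ is the $k$-th coordinate unit vector of $\mathbb R^K$. Objective: $[n]=\{1,\dots,n\}$ is split into $J\ge2$ folds $\mathcal I_1,\dots,\mathcal I_J$ of equal size; given data $(Y_i,X_i)\in\mathcal Y\times\mathbb R^p$ and given $p\times K$ matrices $\hat B^{[-m]}$, $m=1,\dots,J$ (columns are the candidate-model estimators computed without fold $m$), $CV(w)=\sum_{m=1}^J\sum_{i\in\mathcal I_m}L(Y_i,\langle\hat B^{[-m]}w,X_i\rangle)$ for $w\in\mathbb R^K$, where $L:\mathcal Y\times\mathbb R\to\mathbb R$ is convex (and smooth enough for $\nabla^2CV$ to make sense) in its second argument. Algorithm: for $\tilde L>0$ let $G_{\tilde L}(w|w_0)=CV(w_0)+\langle\nabla CV(w_0),w-w_0\rangle+\frac{\tilde L}2\|w-w_0\|_2^2$ and $p_{\tilde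 L}(w_0)=\Pi_{\mathcal W^K}(w_0-\frac1{\tilde L}\nabla CV(w_0))=\operatorname{argmin}_{w\in\mathcal W^K}G_{\tilde L}(w|w_0)$. Initialize $L_0>0$, $A_1=1$, $z^{(1)}=\hat w^{(0)}=e^{(\varsigma)}$ with $\varsigma=\operatorname{argmin}_{k\in[K]}CV(e^{(k)})$, and $\gamma>1$. For $N=1,2,\dots$: find the smallest nonnegative integer $j_N$ such that $CV(p_{\tilde L}(z^{(N)}))\le G_{\tilde L}(p_{\tilde L}(z^{(N)})|z^{(N)})$ with $\tilde L=\gamma^{j_N}L_{N-1}$; set $L_N=\tilde L$, $\hat w^{(N)}=p_{L_N}(z^{(N)})$, $A_{N+1}=\frac{1+\sqrt{1+4A_N^2}}2$, and $z^{(N+1)}=\hat w^{(N)}+\frac{A_N-1}{A_{N+1}}(\hat w^{(N)}-\hat w^{(N-1)})$. (The stopping rule is disregarded, so that iterates are defined for all $N$.)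
   Formalization: The formal theorem adds the assumption that L_0 ≤ γ n L_CV whenever L_CV > 0; without it the bound fails, since backtracking never decreases the constant and a very large L_0 makes every step arbitrarily small. *)

(* Defs.v *)
From HB Require Import structures.
From mathcomp Require Import all_boot all_order all_algebra.
From mathcomp Require Import all_classical all_reals all_analysis.

Set Implicit Arguments.
Unset Strict Implicit.
Unset Printing Implicit Defensive.

Import Order.TTheory GRing.Theory Num.Theory.
Import numFieldNormedType.Exports.

Local Open Scope classical_set_scope.
Local Open Scope ring_scope.

(* The library norm on matrices is the entrywise sup norm, so the Euclidean,
   l1 and spectral norms are defined here. *)

Definition dot {R : realType} {d : nat} (u v : 'cV[R]_d) : R :=
  \sum_(k < d) u k 0 * v k 0.

Definition norm1 {R : realType} {d : nat} (u : 'cV[R]_d) : R :=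
  \sum_(k < d) `|u k 0|.

Definition norm2 {R : realType} {d : nat} (u : 'cV[R]_d) : R :=
  Num.sqrt (\sum_(k < d) u k 0 ^+ 2).

Definition spectral_norm {R : realType} {d : nat} (A : 'M[R]_d) : R :=
  sup [set norm2 (A *m x) | x in [set x : 'cV[R]_d | norm2 x <= 1]].

Definition unit_vec (R : realType) {d : nat} (k : 'I_d) : 'cV[R]_d :=
  delta_mx k 0.
Arguments unit_vec R {d} k.

Definition gradient {R : realType} {d : nat} (F : 'cV[R]_d -> R)
    (w : 'cV[R]_d) : 'cV[R]_d :=
  \col_k 'D_(unit_vec R k) F w.

Definition hessian {R : realType} {d : nat} (F : 'cV[R]_d -> R)
    (w : 'cV[R]_d) : 'M[R]_d :=
  \matrix_(k, l) 'D_(unit_vec R k) (fun v => gradient F v l 0) w.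

Definition is_max {R : realType} (S : set R) (m : R) : Prop :=
  S m /\ ubound S m.

Definition argmin {R : realType} {T : Type} (S : set T) (f : T -> R) : set T :=
  [set x | S x /\ forall y, S y -> f x <= f y].

Definition simplex (R : realType) (K : nat) : set 'cV[R]_K :=
  [set w : 'cV[R]_K | (forall k, 0 <= w k 0 <= 1)
    /\ \sum_(k < K) w k 0 = 1].
Arguments simplex R K : clear implicits.

(* For K > 0 the argmin is a singleton; the default [u] is only returned for
   K = 0, where the simplex is empty. *)
Definition proj_simplex {R : realType} {K : nat} (u : 'cV[R]_K) : 'cV[R]_K :=
  xget u (argmin (simplex R K) (fun w => norm2 (w - u))).

(* Folds are a family [I] of index sets; [B m] is the matrix of candidate
   estimators computed without fold [m]. *)
Definition CV {R : realType} {Yt : Type} {n J p K : nat} (L : Yt -> R -> R)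
    (I : 'I_J -> {set 'I_n}) (Y : 'I_n -> Yt) (X : 'I_n -> 'cV[R]_p)
    (B : 'I_J -> 'M[R]_(p, K)) (w : 'cV[R]_K) : R :=
  \sum_(m < J) \sum_(i in I m) L (Y i) (dot (B m *m w) (X i)).

Definition surrogate {R : realType} {K : nat} (F : 'cV[R]_K -> R) (Lt : R)
    (w w0 : 'cV[R]_K) : R :=
  F w0 + dot (gradient F w0) (w - w0) + Lt / 2 * norm2 (w - w0) ^+ 2.

Definition prox_step {R : realType} {K : nat} (F : 'cV[R]_K -> R) (Lt : R)
    (w0 : 'cV[R]_K) : 'cV[R]_K :=
  proj_simplex (w0 - Lt^-1 *: gradient F w0).

Definition step_ok {R : realType} {K : nat} (F : 'cV[R]_K -> R) (Lt : R)
    (z : 'cV[R]_K) : Prop :=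
  F (prox_step F Lt z) <= surrogate F Lt (prox_step F Lt z) z.

(* [w], [z], [Ls], [A], [j] are the sequences w^(N), z^(N), L_N, A_N, j_N
   produced by the algorithm on the objective [F], without stopping rule.
   [z 0], [A 0] and [j 0] carry no meaning. Ties in the choice of the initial
   vertex are broken arbitrarily. *)
Record fgma_run {R : realType} {K : nat} (F : 'cV[R]_K -> R) (gamma L0 : R)
    (w z : nat -> 'cV[R]_K) (Ls A : nat -> R) (j : nat -> nat) : Prop := {
  run_w0 : exists2 s : 'I_K,
      argmin [set: 'I_K] (fun k => F (unit_vec R k)) s & w 0%N = unit_vec R s;
  run_z1 : z 1%N = w 0%N;
  run_L0 : Ls 0%N = L0;
  run_A1 : A 1%N = 1;
  run_ok : forall N, (0 < N)%N -> step_ok F (gamma ^+ j N * Ls N.-1) (z N);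
  run_least : forall N i, (0 < N)%N -> (i < j N)%N ->
      ~ step_ok F (gamma ^+ i * Ls N.-1) (z N);
  run_L : forall N, (0 < N)%N -> Ls N = gamma ^+ j N * Ls N.-1;
  run_w : forall N, (0 < N)%N -> w N = prox_step F (Ls N) (z N);
  run_A : forall N, (0 < N)%N ->
      A N.+1 = (1 + Num.sqrt (1 + 4 * A N ^+ 2)) / 2;
  run_z : forall N, (0 < N)%N ->
      z N.+1 = w N + ((A N - 1) / A N.+1) *: (w N - w N.-1)
}.

(* Main.v *)
(** [CV] is convex, so it lies above its tangents; along a line its second
    derivative is a quadratic form of the Hessian, so on the l1-ball of radius 5 it
    lies below its tangent plus [n LCV / 2] times the squared distance. The points
    [z N] have l1-norm at most 3, so backtracking stops with [Ls N <= gamma n LCV].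
    The accelerated rate then follows because
    [2 A_N^2 (F w_N - F what) / L_N + |A_N w_N - (A_N - 1) w_(N-1) - what|^2]
    is nonincreasing and [A_N >= (N + 1) / 2]. If [LCV = 0], the bound on [L_N] may
    fail, but then [CV] is affine on the ball and the iterates stay at the initial,
    optimal vertex. *)
Require Import Defs.
From mathcomp Require Import all_boot all_order all_algebra.
From mathcomp Require Import all_classical all_reals all_analysis.
From mathcomp Require Import ring lra.
Import Order.TTheory GRing.Theory Num.Theory.
Import numFieldNormedType.Exports.
Local Open Scope classical_set_scope.
Local Open Scope ring_scope.

(** * Inner product, Euclidean norm and l1 norm *)

Section Dot.
Context {R : realType} {d : nat}.
Implicit Types (u v w : 'cV[R]_d) (a : R).

Lemma dotC u v : dot u v = dot v u.
Proof. by apply: eq_bigr => k _; rewrite mulrC. Qed.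

Lemma dotDl u v w : dot (u + v) w = dot u w + dot v w.
Proof. by rewrite /dot -big_split; apply: eq_bigr => k _; rewrite mxE mulrDl. Qed.

Lemma dotDr u v w : dot u (v + w) = dot u v + dot u w.
Proof. by rewrite dotC dotDl !(dotC u). Qed.

Lemma dotZl a u v : dot (a *: u) v = a * dot u v.
Proof. by rewrite /dot big_distrr /=; apply: eq_bigr => k _; rewrite mxE mulrA. Qed.

Lemma dotZr a u v : dot u (a *: v) = a * dot u v.
Proof. by rewrite dotC dotZl dotC. Qed.

Lemma dotNl u v : dot (- u) v = - dot u v.
Proof. by rewrite -scaleN1r dotZl mulN1r. Qed.

Lemma dotNr u v : dot u (- v) = - dot u v.
Proof. by rewrite dotC dotNl dotC. Qed.

Lemma dot0r u : dot u 0 = 0.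
Proof. by rewrite -(scale0r u) dotZr mul0r. Qed.

Lemma dot0l u : dot 0 u = 0.
Proof. by rewrite dotC dot0r. Qed.

Definition dotE := (dotDl, dotDr, dotNl, dotNr, dotZl, dotZr).

Lemma dot_unit_vec u (k : 'I_d) : dot u (unit_vec R k) = u k 0.
Proof.
rewrite /dot (bigD1 k)//= big1 ?addr0 ?mxE ?eqxx ?mulr1// => i ik.
by rewrite mxE (negPf ik) mulr0.
Qed.

Lemma dotuu_ge0 u : 0 <= dot u u.
Proof. by apply: sumr_ge0 => k _; rewrite -expr2 sqr_ge0. Qed.

Lemma dotuu_eq0 u : dot u u = 0 -> u = 0.
Proof.
move=> /eqP; rewrite psumr_eq0 => [/allP u0|k _]; last first.
  by rewrite -expr2 sqr_ge0.
apply/colP => k; rewrite mxE; apply/eqP.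
by have := u0 k (mem_index_enum k); rewrite /= mulf_eq0 orbb.
Qed.

Lemma norm2E u : norm2 u = Num.sqrt (dot u u).
Proof. by congr Num.sqrt; apply: eq_bigr => k _; rewrite expr2. Qed.

Lemma norm2_ge0 u : 0 <= norm2 u.
Proof. exact: sqrtr_ge0. Qed.

Lemma sqr_norm2 u : norm2 u ^+ 2 = dot u u.
Proof. by rewrite norm2E sqr_sqrtr// dotuu_ge0. Qed.

Lemma ler_norm2 u v : (norm2 u <= norm2 v) = (dot u u <= dot v v).
Proof. by rewrite !norm2E ler_sqrt// dotuu_ge0. Qed.

Lemma norm2Z a u : 0 <= a -> norm2 (a *: u) = a * norm2 u.
Proof.
by move=> a0; rewrite !norm2E !dotE mulrA -expr2 sqrtrM ?sqr_ge0// sqrtr_sqr ger0_norm.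
Qed.

Lemma dot_sqr_le u v : dot u v ^+ 2 <= dot u u * dot v v.
Proof.
have [v0|v_neq0] := eqVneq (dot v v) 0.
  by rewrite (dotuu_eq0 _ v0) !dot0r mulr0 expr0n.
have v_gt0 : 0 < dot v v by rewrite lt_neqAle eq_sym v_neq0 dotuu_ge0.
have := dotuu_ge0 (dot v v *: u - dot u v *: v); rewrite !dotE (dotC v u).
rewrite (_ : _ + _ = dot v v * (dot u u * dot v v - dot u v ^+ 2)); last ring.
by rewrite pmulr_rge0// subr_ge0.
Qed.

Lemma dot_le_norm2 u v : dot u v <= norm2 u * norm2 v.
Proof.
rewrite !norm2E -sqrtrM ?dotuu_ge0//; apply: le_trans (ler_norm _) _.
by rewrite -sqrtr_sqr ler_sqrt ?dot_sqr_le// mulr_ge0 ?dotuu_ge0.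
Qed.

Lemma ler_norm1D u v : norm1 (u + v) <= norm1 u + norm1 v.
Proof.
by rewrite /norm1 -big_split; apply: ler_sum => k _; rewrite mxE ler_normD.
Qed.

Lemma norm1Z a u : norm1 (a *: u) = `|a| * norm1 u.
Proof. by rewrite /norm1 big_distrr /=; apply: eq_bigr => k _; rewrite mxE normrM. Qed.

End Dot.

(** * The spectral norm as a bound on quadratic forms *)

Section SpectralNorm.
Context {R : realType} {d : nat}.
Implicit Types (A : 'M[R]_d) (x : 'cV[R]_d).

Let image A := [set norm2 (A *m x) | x in [set x : 'cV[R]_d | norm2 x <= 1]].

Let norm2_0 : norm2 (0 : 'cV[R]_d) = 0.
Proof. by rewrite -(scale0r 0) norm2Z// mul0r. Qed.

(** The Frobenius norm is an upper bound, by Cauchy-Schwarz on each row. Without boundedness [sup]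
    would be a meaningless default. *)
Lemma has_sup_spectral_norm A : has_sup (image A).
Proof.
split; first by exists (norm2 (A *m 0)), 0 => //=; rewrite norm2_0.
pose r k := (row k A)^T.
exists (Num.sqrt (\sum_k dot (r k) (r k))) => _ [x /= x1 <-].
rewrite norm2E ler_sqrt ?sumr_ge0// => [|k _]; last exact: dotuu_ge0.
apply: ler_sum => k _; rewrite -expr2.
have -> : (A *m x) k 0 = dot (r k) x.
  by rewrite mxE; apply: eq_bigr => l _; rewrite !mxE.
apply: le_trans (dot_sqr_le _ _) _; rewrite ler_piMr ?dotuu_ge0//.
by rewrite -sqr_norm2 expr_le1// norm2_ge0.
Qed.

Lemma spectral_norm_ge0 A : 0 <= spectral_norm A.
Proof.
apply: ub_le_sup; first by case: (has_sup_spectral_norm A).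
by exists 0; rewrite /= ?mulmx0 norm2_0.
Qed.

Lemma dot_mulmx_le A x : dot x (A *m x) <= spectral_norm A * dot x x.
Proof.
have [x0|x_neq0] := eqVneq (norm2 x) 0.
  by apply: le_trans (dot_le_norm2 _ _) _; rewrite -sqr_norm2 x0 expr2 !mul0r mulr0.
have x_gt0 : 0 < norm2 x by rewrite lt_neqAle eq_sym x_neq0 norm2_ge0.
apply: le_trans (dot_le_norm2 _ _) _.
rewrite -sqr_norm2 mulrC expr2 mulrA ler_pM2r//.
rewrite -ler_pdivrMr// mulrC -norm2Z ?invr_ge0 ?norm2_ge0// scalemxAr.
apply: ub_le_sup; first by case: (has_sup_spectral_norm A).
exists ((norm2 x)^-1 *: x) => //=.
by rewrite norm2Z ?invr_ge0 ?norm2_ge0// mulVf.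
Qed.

End SpectralNorm.

(** * Existence and optimality of the projection onto the simplex *)

Lemma sum_continuous {R : realType} {T : topologicalType} {J : finType}
    (f : J -> T -> R) :
  (forall i, continuous (f i)) -> continuous (fun x => \sum_i f i x).
Proof.
move=> fC x; elim: (index_enum J) => [|i r IHr].
  by under eq_fun do rewrite big_nil; exact: cvg_cst.
by under eq_fun do rewrite big_cons; apply: continuousD => //; exact: fC.
Qed.

Section Simplex.
Context {R : realType} {d : nat}.
Implicit Types (u v x y : 'cV[R]_d) (t : R).

Lemma norm1_simplex x : simplex R d x -> norm1 x = 1.
Proof.
move=> [x01 <-]; apply: eq_bigr => k _.
by rewrite ger0_norm//; case/andP: (x01 k).
Qed.

Lemma simplex_unit_vec (k : 'I_d) : simplex R d (unit_vec R k).
Proof.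
split=> [l|]; first by rewrite mxE ler0n lern1 leq_b1.
rewrite (bigD1 k)//= big1 ?addr0 ?mxE ?eqxx// => i ik.
by rewrite mxE (negPf ik).
Qed.

Lemma simplex_segment x y t : 0 <= t <= 1 ->
  simplex R d x -> simplex R d y -> simplex R d (t *: (y - x) + x).
Proof.
move=> t01 [x01 x1] [y01 y1]; split=> [k|].
  by rewrite !mxE; have := x01 k; have := y01 k; nra.
under eq_bigr do rewrite !mxE.
by rewrite big_split /= -big_distrr sumrB /= x1 y1; ring.
Qed.

(** The simplex is closed in a cube, hence compact, and [k] makes it nonempty. Row vectors are used
    because [rV_compact] and [EVT_min_rV] are stated for them. *)
Lemma simplex_has_proj u (k : 'I_d) :
  argmin (simplex R d) (fun w => norm2 (w - u)) !=set0.
Proof.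
pose S := [set v : 'rV[R]_d | simplex R d v^T].
pose f (v : 'rV[R]_d) := dot (v^T - u) (v^T - u).
have coordC i : continuous (fun v : 'rV[R]_d => v 0 i) by exact: coord_continuous.
have Scompact : compact S.
  have -> : S = [set v : 'rV[R]_d | forall i, `[0, 1]%classic (v ord0 i)] `&`
                (fun v : 'rV[R]_d => \sum_i v 0 i) @^-1` [set 1].
    apply/seteqP; split=> v /= [v01 v1];
      by split=> [i|]; [have := v01 i; rewrite mxE /= in_itv
                       |rewrite -v1; apply: eq_bigr => i _; rewrite mxE].
  apply: compact_closedI.
    by apply: (@rV_compact _ _ (fun=> `[0 : R, 1]%classic)) => _; exact: segment_compact.
  apply: closed_comp; last exact: closed_eq.
  by move=> v _; apply: sum_continuous; exact: coordC.
have S0 : S !=set0.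
  by exists (unit_vec R k)^T; rewrite /S /= trmxK; exact: simplex_unit_vec.
have fC : {within S, continuous f}.
  apply: continuous_subspaceT; apply: sum_continuous => i v.
  have uC : {for v, continuous (fun v : 'rV[R]_d => (v^T - u) i 0)}.
    have -> : (fun v : 'rV[R]_d => (v^T - u) i 0) = (fun v : 'rV[R]_d => v 0 i - u i 0).
      by apply/funext => x; rewrite !mxE.
    by apply: continuousB; [exact: coordC|exact: cst_continuous].
  exact: (continuousM uC uC).
have [c /set_mem Sc cmin] := EVT_min_rV S0 Scompact fC.
exists c^T; split=> // y Sy; rewrite ler_norm2.
by have := cmin y^T; rewrite /f trmxK; apply; apply/mem_set; rewrite /S /= trmxK.
Qed.

Lemma proj_simplexP u (k : 'I_d) :
  argmin (simplex R d) (fun w => norm2 (w - u)) (proj_simplex u).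
Proof. exact: xgetPex (simplex_has_proj u k). Qed.

(* First-order optimality of the projection, from comparing it with the points
   of the segment towards [x]. *)
Lemma proj_simplex_obtuse u (k : 'I_d) x : simplex R d x ->
  dot (u - proj_simplex u) (x - proj_simplex u) <= 0.
Proof.
move=> Sx; have [Sp pmin] := proj_simplexP u k; set p := proj_simplex u in Sp pmin *.
have quad t : 0 <= t <= 1 ->
    t * (2 * dot (u - p) (x - p)) <= t * (t * dot (x - p) (x - p)).
  move=> t01; have := pmin _ (simplex_segment _ _ _ t01 Sp Sx).
  rewrite ler_norm2 -addrA -(opprB u p); move: (u - p) (x - p) => q e.
  by rewrite !dotE (dotC e q); lra.
have D0 := dotuu_ge0 (x - p); set D := dot _ _ in D0 quad.
set c := dot _ _ in quad *; rewrite leNgt; apply/negP => c0.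
have cD : 0 < c + D by lra.
(* This [t] gives [t * D = c - t * c < c], against [2 * c <= t * D]; the denominator [c + D] also
   covers [D = 0]. *)
pose t := c / (c + D); have t0 : 0 < t by rewrite divr_gt0.
have t01 : 0 <= t <= 1 by rewrite (ltW t0) ler_pdivrMr// mul1r lerDl.
have := quad t t01; rewrite ler_pM2l// => le_tD.
have tcD : t * (c + D) = c by rewrite divfK// gt_eqF.
have tc : 0 < t * c by rewrite mulr_gt0.
lra.
Qed.

End Simplex.

(** * Derivatives along lines, convex tangents, second-order bound *)

Section Line.
Context {R : realType} {V : normedModType R}.
Implicit Types (F : V -> R) (x v : V).

(** Both sides have the same difference quotient; this brings one-variable calculus to functions of
    a vector. *)
Lemma is_derive_line F x v (t df : R) :
  is_derive t 1 (fun h : R => F (h *: v + x)) df <->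
  is_derive (t *: v + x) v F df.
Proof.
have quotE : (fun h : R => h^-1 *: (F (h *: v + (t *: v + x)) - F (t *: v + x)))
  = (fun h => h^-1 *: (F ((h *: (1 : R) + t) *: v + x) - F (t *: v + x))).
  by apply/funext => h; rewrite [h *: 1]mulr1 scalerDl addrA.
by split=> -[ex val]; split; move: ex val;
  rewrite /derivable /derive /= quotE.
Qed.

End Line.

Lemma is_derive_affine {R : realType} (c a t : R) :
  is_derive t 1 (fun h : R => h * c + a) c.
Proof.
have -> : (fun h : R => h * c + a) = (c \*: (@id R)) + cst a.
  by apply/funext => h; rewrite [LHS]/(h * c + a) (mulrC h).
by apply: is_derive_eq; rewrite addr0 [LHS]mulr1.
Qed.

(** By convexity the difference quotient at [a] in direction [b - a] is at most [f b - f a] for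
    steps in []0, 1]]; the limit from the right keeps the bound. *)
Lemma convex_tangent_le (R : realType) (f : R -> R) :
  @convex_function R R^o [set: R] f -> (forall t, derivable f t 1) ->
  forall a b, f a + derive1 f a * (b - a) <= f b.
Proof.
move=> fconv fder a b.
have df : is_derive (0 : R) 1 (fun h : R => f (h *: (b - a) + a))
    (derive1 f a * (b - a)).
  have -> : (fun h : R => f (h *: (b - a) + a)) = f \o (fun h => h *: (b - a) + a).
    by [].
  apply: is_derive1_comp.
    by rewrite scale0r add0r derive1E; exact: derivableP.
  exact: is_derive_affine.
case: df => dex dval; rewrite -lerBrDl -dval /derive cvg_at_rightE//.
apply: limr_le; first by move/cvg_dnbhs_at_right: dex => /cvgP.
near=> h; have h0 : 0 < h by near: h; exact: nbhs_right_gt.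
have h1 : h <= 1 by near: h; exact: nbhs_right_le.
rewrite /= [h *: 1]mulr1 addr0 scale0r add0r [leLHS]mulrC ler_pdivrMr//.
have : f (h * b + (1 - h) * a) <= h * f b + (1 - h) * f a.
  exact: (fconv (Itv01 (ltW h0) h1) b a (in_setT _) (in_setT _)).
rewrite (_ : h * b + (1 - h) * a = h * (b - a) + a); last by ring.
rewrite -[f (h *: _ + _)]/(f (h * (b - a) + a)); move: (f _) => fh; lra.
Unshelve. all: by end_near.
Qed.

(** The mean value theorem, applied to [phi1] and then to [g], avoids integrating [phi2], which may
    be discontinuous. *)
Lemma le_taylor2 {R : realType} (phi phi1 phi2 : R -> R) (C : R) :
  (forall t : R, is_derive t 1 phi (phi1 t)) ->
  (forall t : R, is_derive t 1 phi1 (phi2 t)) ->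
  (forall t, 0 <= t <= 1 -> phi2 t <= C) ->
  phi 1 <= phi 0 + phi1 0 + C / 2.
Proof.
move=> dphi dphi1 phi2C.
pose g := phi - phi1 0 \*: (@id R) - (C / 2) \*: (@id R ^+ 2).
have dg (t : R) : is_derive t 1 g (phi1 t - phi1 0 - C * t).
  by apply: is_derive_eq; rewrite /= /GRing.scale /= expr1; field.
have within_cont (f f1 : R -> R) (a b : R) :
    (forall t : R, is_derive t 1 f (f1 t)) -> {within `[a, b], continuous f}.
  by move=> df; apply: derivable_within_continuous => t _; case: (df t).
have phi1C t : 0 < t <= 1 -> phi1 t - phi1 0 <= C * t.
  move=> /andP[t0 t1].
  have [c c0t ->] := MVT t0 (fun s _ => dphi1 s) (within_cont _ _ _ _ dphi1).
  move: c0t; rewrite in_itv /= subr0 => /andP[c0 ct].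
  by rewrite ler_pM2r// phi2C// (ltW c0) (le_trans (ltW ct) t1).
have [c c01 gE] := MVT ltr01 (fun s _ => dg s) (within_cont _ _ _ _ dg).
move: c01; rewrite in_itv /= => /andP[c0 c1].
have : g 1 - g 0 <= 0.
  by rewrite gE subr0 mulr1 subr_le0 phi1C// c0 ltW.
have gE' (t : R) : g t = phi t - phi1 0 * t - C / 2 * (t * t) by [].
by rewrite !gE'; lra.
Qed.

(** * Sums of functions of linear forms *)

Section RidgeSum.
Context {R : realType} {K : nat} {Q : finType} (P : pred Q) (a : Q -> 'cV[R]_K).
Implicit Types (f : Q -> R -> R) (w v x y : 'cV[R]_K).

(** The shape of [CV]: [q] is a pair of a fold and an observation, [P] is membership in the fold,
    and [a q] is the transposed estimator matrix applied to the covariates. *)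
Definition ridge_sum f w : R := \sum_(q | P q) f q (dot (a q) w).

Lemma is_derive_ridge_sum f f1 :
  (forall q (t : R), is_derive t 1 (f q) (f1 q t)) ->
  forall w v, is_derive w v (ridge_sum f)
    (\sum_(q | P q) f1 q (dot (a q) w) * dot (a q) v).
Proof.
move=> df w v; rewrite -[w in is_derive w]add0r -(scale0r v).
apply/is_derive_line.
have -> : (fun h : R => ridge_sum f (h *: v + w)) =
    \sum_(q | P q) (f q \o (fun h => h * dot (a q) v + dot (a q) w)).
  by rewrite fct_sumE; apply/funext => h; apply: eq_bigr => q _; rewrite /= !dotE.
elim/big_ind2 : _ => [||q _].
- exact: is_derive_cst.
- by move=> *; exact: is_deriveD.
- apply: is_derive1_comp; last exact: is_derive_affine.
  by rewrite mul0r add0r.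
Qed.

Context (f : Q -> R -> R).
Hypothesis f_diff1 : forall q (t : R), derivable (f q) t 1.
Hypothesis f_diff2 : forall q (t : R), derivable (derive1 (f q)) t 1.

Let f1 q := derive1 (f q).
Let f2 q := derive1 (f1 q).

Let df q (t : R) : is_derive t 1 (f q) (f1 q t).
Proof. by apply: DeriveDef; [exact: f_diff1|rewrite /f1 derive1E]. Qed.

Let df1 q (t : R) : is_derive t 1 (f1 q) (f2 q t).
Proof. by apply: DeriveDef; [exact: f_diff2|rewrite /f2 derive1E]. Qed.

Lemma gradient_ridge_sum w :
  gradient (ridge_sum f) w = \sum_(q | P q) f1 q (dot (a q) w) *: a q.
Proof.
apply/colP => k; rewrite mxE.
have [_ ->] := is_derive_ridge_sum _ _ df w (unit_vec R k).
by rewrite summxE; apply: eq_bigr => q _; rewrite !mxE dot_unit_vec.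
Qed.

Lemma dot_gradient_ridge_sum w v :
  dot (gradient (ridge_sum f) w) v =
  \sum_(q | P q) f1 q (dot (a q) w) * dot (a q) v.
Proof.
rewrite gradient_ridge_sum; elim/big_rec2 : _ => [|q s t _ IH].
  by rewrite dotC dot0r.
by rewrite !dotE IH.
Qed.

Lemma dot_hessian_ridge_sum w v :
  dot v (hessian (ridge_sum f) w *m v) =
  \sum_(q | P q) f2 q (dot (a q) w) * dot (a q) v ^+ 2.
Proof.
have hessE k l : hessian (ridge_sum f) w k l =
    \sum_(q | P q) f2 q (dot (a q) w) * a q k 0 * a q l 0.
  rewrite mxE.
  (* A coordinate of the gradient is again a ridge sum, so the same derivative lemma yields the
     Hessian. *)
  have -> : (fun u => gradient (ridge_sum f) u l 0) =
      ridge_sum (fun q t => a q l 0 * f1 q t).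
    apply/funext => u; rewrite gradient_ridge_sum summxE.
    by apply: eq_bigr => q _; rewrite mxE mulrC.
  have dfl q (t : R) : is_derive t 1 (fun t => a q l 0 * f1 q t) (a q l 0 * f2 q t).
    exact: (@is_deriveZ _ _ _ (f1 q) (a q l 0) t 1 (f2 q t)).
  have [_ ->] := is_derive_ridge_sum _ _ dfl w (unit_vec R k).
  by apply: eq_bigr => q _; rewrite dot_unit_vec; ring.
have -> : hessian (ridge_sum f) w *m v =
    \sum_(q | P q) (f2 q (dot (a q) w) * dot (a q) v) *: a q.
  apply/colP => k; rewrite mxE summxE.
  under eq_bigr => l _ do rewrite hessE big_distrl.
  rewrite exchange_big /=; apply: eq_bigr => q _; rewrite mxE /dot.
  rewrite big_distrr big_distrl /=; apply: eq_bigr => l _; ring.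
elim/big_rec2 : _ => [|q s t _ IH]; first by rewrite dot0r.
by rewrite !dotE IH (dotC v); ring.
Qed.

Lemma ridge_sum_tangent_le :
  (forall q, @convex_function R R^o [set: R] (f q)) ->
  forall x y, ridge_sum f x + dot (gradient (ridge_sum f) x) (y - x) <= ridge_sum f y.
Proof.
move=> fconv x y; rewrite dot_gradient_ridge_sum -big_split /=.
apply: ler_sum => q _; rewrite dotDr dotNr.
exact: convex_tangent_le.
Qed.

(** Restricted to the segment from [x] to [y], which stays in the l1-ball by convexity, the second
    derivative is the quadratic form of the Hessian, and [le_taylor2] applies. *)
Lemma ridge_sum_descent (M r : R) :
  (forall v e, norm1 v <= r ->
    dot e (hessian (ridge_sum f) v *m e) <= M * dot e e) ->
  forall x y, norm1 x <= r -> norm1 y <= r ->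
  ridge_sum f y <= surrogate (ridge_sum f) M y x.
Proof.
move=> hessM x y xr yr; set e := y - x.
pose line (t : R) := t *: e + x.
pose phi t := ridge_sum f (line t).
pose phi1 t := \sum_(q | P q) f1 q (dot (a q) (line t)) * dot (a q) e.
pose phi2 t := \sum_(q | P q) f2 q (dot (a q) (line t)) * dot (a q) e ^+ 2.
have dphi (t : R) : is_derive t 1 phi (phi1 t).
  by apply/is_derive_line; exact: is_derive_ridge_sum.
have dphi1 (t : R) : is_derive t 1 phi1 (phi2 t).
  have dfe q (s : R) :
      is_derive s 1 (fun s => dot (a q) e * f1 q s) (dot (a q) e * f2 q s).
    exact: (@is_deriveZ _ _ _ (f1 q) (dot (a q) e) s 1 (f2 q s)).
  have -> : phi1 =
      (fun h => ridge_sum (fun q s => dot (a q) e * f1 q s) (h *: e + x)).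
    by apply/funext => h; apply: eq_bigr => q _; rewrite mulrC.
  apply/is_derive_line; apply: is_derive_eq.
    exact: (is_derive_ridge_sum _ _ dfe).
  by apply: eq_bigr => q _; ring.
have phi2M t : 0 <= t <= 1 -> phi2 t <= M * dot e e.
  move=> /andP[t0 t1]; rewrite /phi2 -dot_hessian_ridge_sum.
  apply: hessM; have -> : line t = t *: y + (1 - t) *: x.
    by rewrite /line /e scalerBr scalerBl scale1r; rewrite addrAC addrA.
  apply: le_trans (ler_norm1D _ _) _; rewrite !norm1Z !ger0_norm ?subr_ge0//.
  by have t1_ge0 : 0 <= 1 - t; [rewrite subr_ge0|nra].
have := le_taylor2 _ _ _ _ dphi dphi1 phi2M.
have -> : phi1 0 = dot (gradient (ridge_sum f) x) e.
  by rewrite dot_gradient_ridge_sum /phi1 /line scale0r add0r.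
rewrite /phi /line scale0r add0r scale1r subrK /surrogate sqr_norm2 -/e.
by rewrite mulrAC.
Qed.

End RidgeSum.

(** * Accelerated projected descent with backtracking *)

Section AcceleratedDescent.
Context {R : realType} {K : nat} (F : 'cV[R]_K -> R) (M : R).
Hypothesis tangent_le : forall x y, F x + dot (gradient F x) (y - x) <= F y.
Hypothesis descent : forall x y, norm1 x <= 5 -> norm1 y <= 5 ->
  F y <= surrogate F M y x.

(** The tangent at [z] bounds [F x] from below, the accepted step bounds [F p] from above, and the
    obtuse angle at the projection controls the remaining gradient terms. *)
Lemma prox_step_gain (k : 'I_K) (Lt : R) (z x : 'cV[R]_K) :
  0 < Lt -> step_ok F Lt z -> simplex R K x ->
  let p := prox_step F Lt z in
  Lt / 2 * dot (p - z) (p - z) + Lt * dot (z - x) (p - z) <= F x - F p.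
Proof.
move=> L0; rewrite /step_ok /surrogate sqr_norm2; set p := prox_step F Lt z.
set g := gradient F z => ok Sx /=; have tan := tangent_le z x.
rewrite -/g in tan.
have : Lt * dot (z - Lt^-1 *: g - p) (x - p) <= 0.
  by rewrite pmulr_rle0//; exact: proj_simplex_obtuse.
have -> : x - p = - (z - x) - (p - z) by rewrite opprB opprB addrA subrK.
have -> : z - Lt^-1 *: g - p = - (p - z) - Lt^-1 *: g by rewrite opprB addrAC.
have xzE : x - z = - (z - x) by rewrite opprB.
rewrite xzE in tan; move: (p - z) (z - x) => e h in ok tan *.
rewrite !dotE in tan *; rewrite (dotC h e).
rewrite !(mulrDr Lt) !mulrN !mulrA mulfV ?gt_eqF// !mul1r.
lra.
Qed.

Context (gamma L0 : R) (w z : nat -> 'cV[R]_K) (Ls A : nat -> R) (j : nat -> nat).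
Hypothesis gamma_gt1 : 1 < gamma.
Hypothesis L0_gt0 : 0 < L0.
Hypothesis run : fgma_run F gamma L0 w z Ls A j.

Lemma run_ord : 'I_K.
Proof. by have [k] := cid2 (run_w0 run). Qed.

Lemma run_Ls_gt0 N : 0 < Ls N.
Proof.
elim: N => [|N IH]; first by rewrite (run_L0 run).
by rewrite (run_L run)// mulr_gt0// exprn_gt0// (lt_trans ltr01).
Qed.

Lemma run_Ls_homo N : Ls N <= Ls N.+1.
Proof.
by rewrite (run_L run (ltn0Sn N))//= ler_peMl ?exprn_ege1// ltW// run_Ls_gt0.
Qed.

Lemma run_step_ok N : step_ok F (Ls N.+1) (z N.+1).
Proof. by rewrite (run_L run (ltn0Sn N))//; exact: (run_ok run). Qed.

Lemma run_w_simplex N : simplex R K (w N).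
Proof.
case: N => [|N].
  by have [s _ ->] := run_w0 run; exact: simplex_unit_vec.
rewrite (run_w run)//.
by have [] := proj_simplexP (z N.+1 - (Ls N.+1)^-1 *: gradient F (z N.+1)) run_ord.
Qed.

Lemma run_A_ge N : (N.+2)%:R / 2 <= A N.+1.
Proof.
elim: N => [|N IH]; first by rewrite (run_A1 run) divff.
have AN : 0 <= A N.+1 by apply: le_trans IH; rewrite divr_ge0.
have : 2 * A N.+1 <= Num.sqrt (1 + 4 * A N.+1 ^+ 2).
  rewrite -[leLHS]ger0_norm ?mulr_ge0// -sqrtr_sqr ler_sqrt ?exprMn; nra.
rewrite (run_A run (ltn0Sn N)) -(natr1 N.+2); lra.
Qed.

Lemma run_A_ge1 N : 1 <= A N.+1.
Proof.
apply: le_trans (run_A_ge N); rewrite ler_pdivlMr// mul1r ler_nat//.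
Qed.

(** The recursion picks a root of [t ^+ 2 - t = A N.+1 ^+ 2]; this identity makes the Lyapunov
    function telescope. *)
Lemma run_A_sqr N : A N.+2 ^+ 2 - A N.+2 = A N.+1 ^+ 2.
Proof.
rewrite (run_A run (ltn0Sn N))//.
have := @sqr_sqrtr R (1 + 4 * A N.+1 ^+ 2); set s := Num.sqrt _ => ss.
have {}ss : s ^+ 2 = 1 + 4 * A N.+1 ^+ 2.
  by apply: ss; have := sqr_ge0 (A N.+1); lra.
by field: ss.
Qed.

Lemma run_z_norm1 N : norm1 (z N.+1) <= 5.
Proof.
case: N => [|N].
  by rewrite (run_z1 run) (norm1_simplex _ (run_w_simplex 0)); lra.
rewrite (run_z run)//=; set b := _ / _; rewrite -[X in _ *: (_ + X)]scaleN1r.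
(* With momentum factor [b] in [[0, 1]] and iterates of l1-norm 1, the extrapolated point has norm
   at most [1 + 2 * b <= 3]. *)
have b01 : 0 <= b <= 1.
  have A1 := run_A_ge1 N; have A2 := run_A_ge1 N.+1; have A12 := run_A_sqr N.
  have A2_gt0 : 0 < A N.+2 by lra.
  rewrite /b divr_ge0 ?subr_ge0 ?(ltW A2_gt0)//= ler_pdivrMr// mul1r leNgt.
  by apply/negP => lt_A; nra.
have w1 n : norm1 (w n) = 1 by exact: norm1_simplex (run_w_simplex n).
apply: le_trans (ler_norm1D _ _) _; rewrite norm1Z w1.
have := ler_norm1D (w N.+1) (-1 *: w N); rewrite norm1Z !w1 normrN1 ger0_norm; nra.
Qed.

(** If the constant grew, the preceding trial failed; by [descent] every trial above [M] succeeds,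
    so the failed one was at most [M] and the accepted one is [gamma] times it. *)
Lemma run_Ls_le N : L0 <= gamma * M -> Ls N <= gamma * M.
Proof.
move=> L0M; elim: N => [|N IH]; first by rewrite (run_L0 run).
have [j0|j_gt0] := posnP (j N.+1).
  by rewrite (run_L run)// j0 mul1r.
rewrite (run_L run)//= -(prednK j_gt0) exprS -mulrA ler_pM2l ?(lt_trans ltr01)//.
rewrite leNgt; apply/negP => M_lt.
apply: (run_least run (N := N.+1) (i := (j N.+1).-1)) => //=; first by rewrite ltn_predL.
set Lt := gamma ^+ _ * _ in M_lt *; rewrite /step_ok.
have [Sp _] := proj_simplexP (z N.+1 - Lt^-1 *: gradient F (z N.+1)) run_ord.
apply: le_trans (descent _ _ (run_z_norm1 N) _) _.
  by rewrite norm1_simplex//; lra.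
by rewrite lerD2l ler_wpM2r ?sqr_ge0// ler_wpM2r// ltW.
Qed.

Context (what : 'cV[R]_K).
Hypothesis what_argmin : argmin (simplex R K) F what.

Let gap N := F (w N) - F what.
Let drift N := A N *: w N - (A N - 1) *: w N.-1 - what.

Let gap_ge0 N : 0 <= gap N.
Proof. by rewrite subr_ge0; apply: what_argmin.2; exact: run_w_simplex. Qed.

(* The Lyapunov function of accelerated proximal gradient descent, multiplied
   by [Ls N] to avoid divisions. *)
Lemma run_lyapunov N :
  2 * A N.+1 ^+ 2 * gap N.+1 + Ls N.+1 * dot (drift N.+1) (drift N.+1) <=
  Ls N.+1 * dot (w 0%N - what) (w 0%N - what).
Proof.
elim: N => [|N IH].
  have := prox_step_gain run_ord _ _ _ (run_Ls_gt0 1) (run_step_ok 0) what_argmin.1.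
  rewrite -(run_w run)// /gap /drift (run_A1 run) (run_z1 run) subrr scale0r subr0 scale1r.
  have -> : w 1%N - what = (w 1%N - w 0%N) + (w 0%N - what) by rewrite addrA subrK.
  move: (w 1%N - w 0%N) (w 0%N - what) => e h.
  by rewrite !dotE (dotC h e); lra.
set s := A N.+1 in IH *; set t := A N.+2.
have s1 : 1 <= s := run_A_ge1 N; have t1 : 1 <= t := run_A_ge1 N.+1.
have st : s ^+ 2 = t ^+ 2 - t by rewrite /s /t run_A_sqr.
have ok := run_step_ok N.+1; have L_gt0 := run_Ls_gt0 N.+2.
have gainx := prox_step_gain run_ord _ _ _ L_gt0 ok (run_w_simplex N.+1).
have gainy := prox_step_gain run_ord _ _ _ L_gt0 ok what_argmin.1.
rewrite -(run_w run)//= in gainx gainy.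
(* The momentum coefficient is chosen exactly so that the old drift can be expressed through
   [z N.+2]. *)
have driftE : drift N.+1 = t *: z N.+2 - (t - 1) *: w N.+1 - what.
  rewrite (run_z run)// /drift /= -/s -/t scalerDr scalerA mulrCA.
  rewrite divff ?gt_eqF ?(lt_le_trans ltr01)//.
  apply/colP => k; rewrite !mxE; ring.
have step : 2 * t ^+ 2 * gap N.+2 + Ls N.+2 * dot (drift N.+2) (drift N.+2) <=
    2 * s ^+ 2 * gap N.+1 + Ls N.+2 * dot (drift N.+1) (drift N.+1).
  have -> : drift N.+2 = t *: (w N.+2 - z N.+2) + drift N.+1.
    by rewrite driftE /drift /= -/t; apply/colP => k; rewrite !mxE; ring.
  rewrite driftE.
  have -> : t *: z N.+2 - (t - 1) *: w N.+1 - what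
      = (t - 1) *: (z N.+2 - w N.+1) + (z N.+2 - what).
    by apply/colP => k; rewrite !mxE; ring.
  rewrite st /gap; move: gainx gainy.
  move: (w N.+2 - z N.+2) (z N.+2 - w N.+1) (z N.+2 - what) => e hx hy gainx gainy.
  rewrite !dotE (dotC hy hx) (dotC e hx) (dotC e hy).
  have t0 : 0 <= t by lra.
  have tt : 0 <= t * (t - 1) by rewrite mulr_ge0// subr_ge0.
  (* With these weights the right sides add up to [s ^+ 2 * gap N.+1 - t ^+ 2 * gap N.+2], and the
     left sides to [Ls N.+2 / 2] times the increase of the squared drift. *)
  have := ler_wpM2l tt gainx; have := ler_wpM2l t0 gainy.
  lra.
apply: le_trans step _.
have := run_Ls_homo N.+1; have := run_Ls_gt0 N.+1; have := gap_ge0 N.+1.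
move: IH; set U := dot _ _; set D := dot _ _ => IH g0 l0 ll.
have sg : 0 <= s ^+ 2 * gap N.+1 by rewrite mulr_ge0// sqr_ge0.
(* [step] carries the weight [Ls N.+2], the induction hypothesis only [Ls N.+1]; the excess weight
   multiplies [U] on the left and [D] on the right. *)
have UD : U <= D by rewrite -(ler_pM2l l0); lra.
nra.
Qed.

Lemma run_rate N : (0 < N)%N -> L0 <= gamma * M ->
  F (w N) <= F what + 2 * gamma * M * norm2 (w 0%N - what) ^+ 2 / N.+1%:R ^+ 2.
Proof.
case: N => // N _ L0M; rewrite -lerBlDl -/(gap N.+1) sqr_norm2.
have := run_lyapunov N; have := run_Ls_le N.+1 L0M; have := run_A_ge N.
have := dotuu_ge0 (drift N.+1); have := run_Ls_gt0 N.+1.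
have := dotuu_ge0 (w 0%N - what); set D := dot _ _; set U := dot _ _.
have := gap_ge0 N.+1; set c : R := N.+2%:R; have c_gt0 : 0 < c by rewrite ltr0n.
move=> g0 D0 l0 U0 cA lM lyap; rewrite ler_pdivlMr ?exprn_gt0//.
(* Through [A N.+1 >= c / 2], the bound [2 * A N.+1 ^+ 2 * gap N.+1 <= gamma * M * D] becomes the
   rate with constant 2. *)
have cA2 : c ^+ 2 <= 4 * A N.+1 ^+ 2 by nra.
have LU : 0 <= Ls N.+1 * U by rewrite mulr_ge0// ltW.
have LD : Ls N.+1 * D <= gamma * M * D by rewrite ler_wpM2r.
have cg : gap N.+1 * c ^+ 2 <= gap N.+1 * (4 * A N.+1 ^+ 2) by rewrite ler_wpM2l.
lra.
Qed.

(* With zero curvature [F] is affine on the l1-ball, so the best vertex is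
   already optimal and the iteration never leaves it. *)
Lemma run_flat N : M <= 0 -> F (w N) <= F what.
Proof.
move=> M0.
have flat x : simplex R K x -> F (w 0%N) <= F x.
  have [s [_ smin] w0E] := run_w0 run; set x0 := w 0%N in w0E *.
  have x05 : norm1 x0 <= 5 by rewrite (norm1_simplex _ (run_w_simplex 0)); lra.
  (* No vertex beats [x0], and with [M <= 0] the surrogate is at most its affine part, so the linear
     term is nonnegative. *)
  have slope k : 0 <= dot (gradient F x0) (unit_vec R k) - dot (gradient F x0) x0.
    rewrite -dotNr -dotDr.
    have := descent x0 (unit_vec R k) x05.
    rewrite norm1_simplex ?ler1n; last exact: simplex_unit_vec.
    move=> /(_ isT); have := smin k I; rewrite -w0E /surrogate.
    have : 0 <= norm2 (unit_vec R k - x0) ^+ 2 by rewrite sqr_ge0.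
    by nra.
  move=> [x01 x1]; apply: le_trans (tangent_le x0 x); rewrite lerDl dotDr dotNr.
  (* As the coordinates of [x] sum to 1, the slope towards [x] is a weighted average of the slopes
     towards the vertices. *)
  rewrite -[dot _ x0]mul1r -x1 big_distrl -sumrB; apply: sumr_ge0 => k _.
  rewrite /=; have := slope k; rewrite dot_unit_vec; have /andP[] := x01 k; nra.
suff wz n : w n = w 0%N /\ z n.+1 = w 0%N.
  by have [-> _] := wz N; exact: flat what_argmin.1.
elim: n => [|n [wn zn]]; first by rewrite (run_z1 run).
have wSn : w n.+1 = w 0%N.
  (* Since [z n.+1 = w 0], the gain inequality bounds a positive multiple of the squared
     displacement by [F (w 0) - F (w n.+1) <= 0]. *)
  have := prox_step_gain run_ord _ _ _ (run_Ls_gt0 n.+1) (run_step_ok n) (run_w_simplex 0).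
  rewrite -(run_w run)//= zn subrr dot0l mulr0 addr0.
  have := flat _ (run_w_simplex n.+1); have := run_Ls_gt0 n.+1.
  have := dotuu_ge0 (w n.+1 - w 0%N) => e0 l0 le1 le2.
  apply/eqP; rewrite -subr_eq0; apply/eqP/dotuu_eq0/le_anti.
  by rewrite e0 andbT; nra.
by rewrite (run_z run)//= wSn wn subrr scaler0 addr0.
Qed.

End AcceleratedDescent.

(** [L0_le] starts the induction bounding [Ls]: as [Ls] never decreases, an initial value above
    [gamma * (n%:R * LCV)] would stay above it. *)
Theorem theorem13 (R : realType) (Yt : Type) (n J p K : nat)
  (n_gt0 : (0 < n)%N) (J_ge2 : (2 <= J)%N)
  (I : 'I_J -> {set 'I_n})
  (I_part : forall i : 'I_n, exists! m : 'I_J, i \in I m)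
  (I_eqsize : forall m m' : 'I_J, #|I m| = #|I m'|)
  (Y : 'I_n -> Yt) (X : 'I_n -> 'cV[R]_p) (B : 'I_J -> 'M[R]_(p, K))
  (L : Yt -> R -> R)
  (L_convex : forall y : Yt, @convex_function R R^o [set: R] (L y))
  (L_diff1 : forall (y : Yt) (t : R), derivable (L y) t 1)
  (L_diff2 : forall (y : Yt) (t : R), derivable (derive1 (L y)) t 1)
  (gamma L0 : R) (gamma_gt1 : 1 < gamma) (L0_gt0 : 0 < L0)
  (LCV : R)
  (LCV_max : is_max
     [set spectral_norm (n%:R^-1 *: hessian (CV L I Y X B) v)
        | v in [set v : 'cV[R]_K | norm1 v <= 5]] LCV)
  (L0_le : 0 < LCV -> L0 <= gamma * (n%:R * LCV))
  (w z : nat -> 'cV[R]_K) (Ls A : nat -> R) (j : nat -> nat)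
  (run : fgma_run (CV L I Y X B) gamma L0 w z Ls A j)
  (what : 'cV[R]_K)
  (what_argmin : argmin (simplex R K) (CV L I Y X B) what)
  (N : nat) (N_gt0 : (0 < N)%N) :
  CV L I Y X B (w N) / n%:R <=
    CV L I Y X B what / n%:R
    + 2 * gamma * LCV * norm2 (w 0%N - what) ^+ 2 / N.+1%:R ^+ 2.
Proof.
have nR_gt0 : 0 < n%:R :> R by rewrite ltr0n.
set F := CV L I Y X B in LCV_max run what_argmin *.
(* The double sum becomes a sum over pairs, and [B] crosses the inner product by transposition. *)
have FE : F = ridge_sum (fun q : 'I_J * 'I_n => q.2 \in I q.1)
    (fun q => (B q.1)^T *m X q.2) (fun q => L (Y q.2)).
  apply/funext => v; rewrite /F /CV pair_big_dep /=; apply: eq_bigr => q _.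
  congr (L _ _); rewrite /dot.
  under eq_bigr do rewrite mxE big_distrl.
  rewrite exchange_big; apply: eq_bigr => k _.
  rewrite mxE big_distrl; apply: eq_bigr => i _ /=.
  by rewrite mxE; ring.
have tangent_le x y : F x + dot (gradient F x) (y - x) <= F y.
  by rewrite FE; apply: ridge_sum_tangent_le.
have descent x y : norm1 x <= 5 -> norm1 y <= 5 -> F y <= surrogate F (n%:R * LCV) y x.
  rewrite FE; apply: ridge_sum_descent => // v e v5; rewrite -FE.
  (* [LCV] bounds the Hessian divided by [n], whence the curvature constant [n%:R * LCV]. *)
  have -> : hessian F v = n%:R *: (n%:R^-1 *: hessian F v).
    by rewrite scalerA divff ?gt_eqF// scale1r.
  rewrite -scalemxAl dotZr -mulrA ler_pM2l//.
  apply: le_trans (dot_mulmx_le _ _) _; rewrite ler_wpM2r ?dotuu_ge0//.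
  by apply: LCV_max.2; exists v.
have LCV_ge0 : 0 <= LCV by have [[v _ <-] _] := LCV_max; exact: spectral_norm_ge0.
have [LCV0|LCV_neq0] := eqVneq LCV 0.
  rewrite LCV0 mulr0 !mul0r addr0 ler_pM2r ?invr_gt0//.
  apply: (run_flat _ _ tangent_le descent _ _ _ _ _ _ _ gamma_gt1 L0_gt0 run) => //.
  by rewrite LCV0 mulr0.
have LCV_gt0 : 0 < LCV by rewrite lt_neqAle eq_sym LCV_neq0.
have := run_rate _ _ tangent_le descent _ _ _ _ _ _ _ gamma_gt1 L0_gt0 run
  _ what_argmin _ N_gt0 (L0_le LCV_gt0).
rewrite -(ler_pM2r (_ : 0 < n%:R^-1)) ?invr_gt0// => /le_trans; apply.
by rewrite le_eqVlt; apply/orP/or_introl/eqP; field; rewrite !gt_eqF ?ltr0n.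
Qed.
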